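(* Let $n\ge i\ge 0$ be integers. Then: (i) player $B$ has a winning strategy for chomp on $\mathcal{K}_n^i$ when $n\equiv 1$ and $i\equiv 0\pmod 3$, and when $n\equiv 2$ and $i\equiv 2\pmod 3$; otherwise $B$ loses. (ii) player $B$ has a winning strategy for chomp on $\mathcal{K}_n^{0,i}$ when $n\equiv i\equiv 0\pmod 3$, and when $n\equiv 2$ and $i\equiv 1\pmod 3$; otherwise $B$ loses. (iii) player $A$ has a winning strategy for chomp on $\mathcal{K}_n^{1,i}$ when $(n \bmod 3, i\bmod 3)\in\{(0,0),(0,2),(1,0),(1,1),(2,1),(2,2)\}$. (iv) for every integer $j$ with $0\le j\le n$, player $A$ has a winning strategy for chomp on $\mathcal{K}_n^{j,i}$ when $n\equiv 1$ and $i\equiv 0\pmod 3$, and when $n\equiv i\equiv 2\pmod 3$.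
   Context: Chomp on a finite graph: two players, $A$ moving first and then $B$, alternately remove either an edge or a vertex together with all its incident edges; the player who cannot move (the graph is empty) loses. For integers $n\ge 0$ and $0\le i_1,\dots,i_k\le n$, the graph $\mathcal{K}_n^{i_1,\dots,i_k}$ consists of a complete graph on vertices $u_1,\dots,u_n$ together with $k$ further vertices, the $j$-th of which is adjacent exactly to $u_1,\dots,u_{i_j}$ (and to no other vertex). *)

(* Defs.v *)
From HB Require Import structures.
From mathcomp Require Import all_boot.

Set Implicit Arguments.
Unset Strict Implicit.
Unset Printing Implicit Defensive.

(* A finite simple graph with vertices drawn from an ambient finite type; the
   vertex set is part of the data since vertices get removed during play. *)
Section Graphs.

Variable T : finType.

Definition edges_ok (VE : {set T} * {set {set T}}) : bool :=
  [forall e in VE.2, (e \subset VE.1) && (#|e| == 2)].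

Record graph := Graph { graph_val : {set T} * {set {set T}};
                        _ : edges_ok graph_val }.

HB.instance Definition _ := [isSub for graph_val].
HB.instance Definition _ := [Finite of graph by <:].

Definition vset (G : graph) : {set T} := (val G).1.
Definition eset (G : graph) : {set {set T}} := (val G).2.

Lemma del_edge_ok (G : graph) (e : {set T}) :
  edges_ok (vset G, eset G :\ e).
Proof.
case: G => -[V E] okG; apply/forall_inP=> f; rewrite in_setD1 => /andP[_ fE].
exact: (forall_inP okG).
Qed.

Definition del_edge (G : graph) (e : {set T}) : graph :=
  Graph (del_edge_ok G e).

Lemma del_vertex_ok (G : graph) (v : T) :
  edges_ok (vset G :\ v, [set e in eset G | v \notin e]).
Proof.
case: G => -[V E] okG; apply/forall_inP=> f; rewrite inE => /andP[fE vf].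
by have /andP[fV ->] := forall_inP okG f fE; rewrite subsetD1 fV vf.
Qed.

Definition del_vertex (G : graph) (v : T) : graph :=
  Graph (del_vertex_ok G v).

Definition move : rel graph := fun G G' =>
  [exists e in eset G, G' == del_edge G e]
  || [exists v in vset G, G' == del_vertex G v].

End Graphs.

Inductive player := PlayerA | PlayerB.

(* The player who makes move number t, moves being numbered from 0. *)
Definition mover (t : nat) : player := if odd t then PlayerB else PlayerA.

Section Chomp.

Variable T : finType.

Definition strategy := graph T -> graph T.

Definition legal (s : strategy) : Prop :=
  forall G, vset G != set0 -> move G (s G).

(* A play from G is the sequence p of positions reached after G. *)
Definition follows (P : player) (s : strategy) (G : graph T)
    (p : seq (graph T)) : Prop :=
  forall t, t < size p -> mover t = P -> nth G p t = s (nth G (G :: p) t).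

Definition complete_play (G : graph T) (p : seq (graph T)) : Prop :=
  path (@move T) G p /\ vset (last G p) = set0.

(* In a complete play p, the player who has to make move number size p
   is the one who cannot move. *)
Definition loser (p : seq (graph T)) : player := mover (size p).

Definition has_winning_strategy (P : player) (G : graph T) : Prop :=
  exists2 s : strategy, legal s &
    forall p, complete_play G p -> follows P s G p -> loser p <> P.

End Chomp.

(* In Kgraph n [:: i_1; ...; i_k], inl a stands for u_(a+1), and inr j for the
   (j+1)-st further vertex. *)
Section CompleteWithExtra.

Variables (n : nat) (s : seq nat).

Definition Kadj (x y : 'I_n + 'I_(size s)) : bool :=
  match x, y with
  | inl a, inl b => a != b
  | inl a, inr j | inr j, inl a => a < nth 0 s j
  | inr _, inr _ => false
  end.

Definition Kedges : {set {set 'I_n + 'I_(size s)}} :=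
  [set e | [exists x, exists y, Kadj x y && (e == [set x; y])]].

Lemma K_ok : edges_ok ([set: 'I_n + 'I_(size s)], Kedges).
Proof.
apply/forall_inP=> e; rewrite inE subsetT /=.
move=> /existsP[x /existsP[y /andP[xy /eqP->]]]; rewrite cards2.
suff -> : x != y by [].
by apply: contraTneq xy => ->; case: y => [b|j] //=; rewrite eqxx.
Qed.

Definition Kgraph : graph ('I_n + 'I_(size s))%type := Graph K_ok.

End CompleteWithExtra.

(* Main.v *)
Require Import Defs.
From mathcomp Require Import all_boot.
From mathcomp Require Import zify.

Set Implicit Arguments.
Unset Strict Implicit.
Unset Printing Implicit Defensive.

(* Let P-positions be those lost for the player to move. If two non-adjacent
   vertices have the same neighbours, deleting both does not change the outcome,
   because every move touching only one of them can be mirrored. Deleting an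
   edge u_a u_b of K_n^i or K_n^{0,i} whose ends are both adjacent, or both
   non-adjacent, to the further vertex w thus amounts to decreasing n by 2. If
   only u_a is adjacent to w, the ends become twins after deleting w or the edge
   w u_a, and one of these two replies is a P-position whenever K_n^i (resp.
   K_n^{0,i}) is claimed to be one. All remaining moves stay in the family, so
   (i) and (ii) follow by an induction with a check modulo 3. In (iii) and (iv)
   a single move reaches a P-position of (i) or (ii): delete a further vertex,
   the pendant edge, or u_1. *)

(** * Adjacency and its change under the two kinds of move *)

Lemma eq_set2 (T : finType) (x y a b : T) :
  ([set x; y] == [set a; b]) = (x == a) && (y == b) || (x == b) && (y == a).
Proof.
apply/eqP/idP => [/setP E|/orP[/andP[/eqP-> /eqP->]//|/andP[/eqP-> /eqP->]]];
  last by rewrite setUC.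
have := E x; have := E y; have := E a; have := E b.
rewrite !inE !eqxx (eq_sym a x) (eq_sym a y) (eq_sym b x) (eq_sym b y) /= !orbT.
case xa: (x == a); case xb: (x == b); case ya: (y == a); case yb: (y == b) => //.
Qed.

Section Positions.

Variable T : finType.
Implicit Types (G H : graph T) (x y a b c v : T).

Definition adj G x y := [set x; y] \in eset G.

Definition cut G x y := del_edge G [set x; y].

Lemma adj_sym G x y : adj G x y = adj G y x.
Proof. by rewrite /adj setUC. Qed.

Lemma cutC G x y : cut G x y = cut G y x.
Proof. by rewrite /cut setUC. Qed.

Lemma eset_edge G e : e \in eset G -> e \subset vset G /\ #|e| = 2.
Proof.
by case: G => VE okG /= eG; have /andP[-> /eqP->] := forall_inP okG e eG.
Qed.

Lemma adj_irrefl G x : adj G x x = false.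
Proof. by apply/negP => /eset_edge[_]; rewrite setUid cards1. Qed.

Lemma adj_vset G x y : adj G x y -> (x \in vset G) && (y \in vset G).
Proof. by case/eset_edge => + _; rewrite subUset !sub1set. Qed.

Lemma eset_adj G e : e \in eset G -> exists x y, adj G x y /\ e = [set x; y].
Proof.
move=> eG; have [_ /eqP/cards2P[x [y [_ e2]]]] := eset_edge eG.
by exists x, y; rewrite /adj -e2.
Qed.

(** Every edge is a pair, so adjacency determines the edge set. Equalities between positions are
    checked pointwise through this. *)
Lemma graph_ext G H : vset G = vset H -> adj G =2 adj H -> G = H.
Proof.
move=> eV eA; apply: val_inj.
rewrite (surjective_pairing (val G)) (surjective_pairing (val H)).
congr (_, _); first exact: eV.
apply/setP => e; apply/idP/idP => /eset_adj[x [y [+ ->]]];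
  by [rewrite eA | rewrite -eA].
Qed.

Lemma vset_cut G a b : vset (cut G a b) = vset G.
Proof. by []. Qed.

Lemma adj_cut G a b x y :
  adj (cut G a b) x y =
  ~~ ((x == a) && (y == b) || (x == b) && (y == a)) && adj G x y.
Proof. by rewrite /adj {1}/eset /= in_setD1 eq_set2. Qed.

Lemma vset_del G v : vset (del_vertex G v) = vset G :\ v.
Proof. by []. Qed.

Lemma adj_del G v x y :
  adj (del_vertex G v) x y = [&& x != v, y != v & adj G x y].
Proof.
rewrite /adj {1}/eset /= !inE negb_or (eq_sym v) (eq_sym v).
by rewrite andbC andbA.
Qed.

(** * Outcomes of positions and winning strategies *)

Definition gsize G := #|vset G| + #|eset G|.

Lemma gsize_cut G a b : adj G a b -> gsize (cut G a b) < gsize G.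
Proof.
rewrite /adj => ab; rewrite /gsize vset_cut {1}/eset /=.
by rewrite (cardsD1 [set a; b] (eset G)) ab ltn_add2l.
Qed.

Lemma gsize_del G v : v \in vset G -> gsize (del_vertex G v) < gsize G.
Proof.
move=> vG; rewrite /gsize vset_del (cardsD1 v (vset G)) vG -addnA add1n ltnS leq_add2l.
by apply: subset_leq_card; apply/subsetP => e; rewrite inE => /andP[].
Qed.

Variant move_spec G : graph T -> Prop :=
  | MoveEdge a b of adj G a b : move_spec G (cut G a b)
  | MoveVertex v of v \in vset G : move_spec G (del_vertex G v).

Lemma moveP G H : reflect (move_spec G H) (move G H).
Proof.
apply: (iffP orP) => [[/exists_inP[e + /eqP->]|/exists_inP[v vG /eqP->]]|].
- by case/eset_adj => [a [b [ab ->]]]; apply: MoveEdge.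
- exact: MoveVertex.
- case=> [a b ab|v vG]; [left|right]; apply/exists_inP.
    by exists [set a; b].
  by exists v.
Qed.

Lemma gsize_move G H : move G H -> gsize H < gsize G.
Proof. by case/moveP => *; [apply: gsize_cut | apply: gsize_del]. Qed.

(** Recursion on fuel, since moves are not structurally decreasing. The value at fuel 0 is right for
    [gsize G = 0], where no move exists. *)
Fixpoint lost_rec k G : bool :=
  if k is k'.+1 then [forall H, move G H ==> ~~ lost_rec k' H] else true.

Definition lost G := lost_rec (gsize G) G.

Lemma lost_recE k l G : gsize G <= k -> gsize G <= l -> lost_rec k G = lost_rec l G.
Proof.
have gs0 H : gsize H <= 0 -> forall m, lost_rec m H.
  by move=> H0 [|m] //=; apply/forallP => K; apply/implyP => /gsize_move; lia.
elim: k l G => [|k IH] [|l] G // Gk Gl; try by rewrite !gs0.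
apply: eq_forallb => H; case mGH: (move G H) => //=.
by have := gsize_move mGH => ?; congr (~~ _); apply: IH; lia.
Qed.

Lemma lostP G : reflect (forall H, move G H -> ~~ lost H) (lost G).
Proof.
rewrite /lost (@lost_recE _ (gsize G).+1) //=.
apply: (iffP forallP) => L H => [mGH|].
  have := L H; rewrite mGH /=; rewrite (@lost_recE _ (gsize H)) //.
  exact/ltnW/gsize_move.
apply/implyP => mGH; rewrite (@lost_recE _ (gsize H)) ?L //.
exact/ltnW/gsize_move.
Qed.

Lemma lost_intro G :
  (forall a b, adj G a b -> ~~ lost (cut G a b)) ->
  (forall v, v \in vset G -> ~~ lost (del_vertex G v)) -> lost G.
Proof. by move=> hE hV; apply/lostP => H /moveP[]. Qed.

Lemma notlost_edge G a b : adj G a b -> lost (cut G a b) -> ~~ lost G.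
Proof.
move=> ab lH; apply/lostP => /(_ (cut G a b)); rewrite lH => F.
by have /F : move G (cut G a b) by apply/moveP; constructor.
Qed.

Lemma notlost_vertex G v :
  v \in vset G -> lost (del_vertex G v) -> ~~ lost G.
Proof.
move=> vG lH; apply/lostP => /(_ (del_vertex G v)); rewrite lH => F.
by have /F : move G (del_vertex G v) by apply/moveP; constructor.
Qed.

Lemma notlostP G : ~~ lost G -> exists2 H, move G H & lost H.
Proof.
case: (boolP [exists H, move G H && lost H]).
  by move=> /existsP[H /andP[]]; exists H.
rewrite negb_exists => /forallP L /negP[]; apply/lostP => H mGH.
by have := L H; rewrite mGH.
Qed.

(** The second [pick] is there because [legal] demands a move from every nonempty position, lost
    ones included. The default [G] is reached only when no move exists. *)
Definition best G : graph T :=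
  if [pick H | move G H && lost H] is Some H then H
  else odflt G [pick H | move G H].

Lemma best_legal : legal best.
Proof.
move=> G /set0Pn[v vG]; rewrite /best.
case: pickP => [H /andP[]//|_]; case: pickP => [//|/(_ (del_vertex G v))].
by have -> : move G (del_vertex G v) by apply/moveP; constructor.
Qed.

Lemma best_lost G : ~~ lost G -> lost (best G).
Proof.
case/notlostP => H mGH lH; rewrite /best.
by case: pickP => [K /andP[]//|/(_ H)]; rewrite mGH lH.
Qed.

(* [c] is the parity of the moves made according to [best]. *)
Lemma play_parity (c : bool) (p : seq (graph T)) G :
  complete_play G p -> lost G = c ->
  (forall t, t < size p -> odd t = c -> nth G p t = best (nth G (G :: p) t)) ->
  odd (size p) = ~~ c.
Proof.
elim: p c G => [|H p IH] c G [] /=.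
  move=> _ V0 <- _; apply/esym/negbTE; rewrite negbK.
  apply: lost_intro => [a b /adj_vset|v]; by rewrite V0 inE.
(* The first move flips the outcome: every move from a lost position does, and from any other the
   move is the one of [best]. *)
move=> /andP[mGH pH] V0 lG F; rewrite (IH (~~ c) H) ?negbK //.
  case: c lG F => lG F; first by apply/negbTE; move/lostP: lG => /(_ _ mGH).
  by have /= -> := F 0 isT erefl; apply: best_lost; rewrite lG.
(* Move [t] of the tail is move [t.+1] of the whole play; the index is in range, so the default of
   [nth] may change from [H] to [G]. *)
move=> t tp ot; rewrite (set_nth_default G) //.
have := F t.+1 tp; rewrite /= ot negbK => /(_ erefl) ->; congr best.
exact: (@set_nth_default _ (H :: p) H G t (ltnW tp)).
Qed.

(** With [c = lost G], the moves numbered with parity [c] are exactly those of the claimed winner,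
    who plays [best]. *)
Lemma lost_winner G :
  has_winning_strategy (if lost G then PlayerB else PlayerA) G.
Proof.
exists best; first exact: best_legal.
move=> p pl F; have := @play_parity (lost G) p G pl erefl.
rewrite /loser /mover => -> //.
  by case: (lost G).
by move=> t tp ot; apply: F => //; rewrite /mover ot; case: (lost G).
Qed.

Lemma notlost_winA G : ~~ lost G -> has_winning_strategy PlayerA G.
Proof. by have := lost_winner G => + /negbTE lG; rewrite lG. Qed.

(** * Commuting moves, and twin vertices *)

Lemma del_vertexC G a b :
  del_vertex (del_vertex G a) b = del_vertex (del_vertex G b) a.
Proof.
apply: graph_ext => [|x y]; first by apply/setP => x; rewrite !inE andbCA.
by rewrite !adj_del; do ![case: (_ == _)]=> //=; rewrite ?andbF.
Qed.

Lemma del_vertex_cut G a b : del_vertex (cut G a b) a = del_vertex G a.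
Proof.
apply: graph_ext => [|x y]; first by apply/setP => x; rewrite !inE.
by rewrite !adj_del adj_cut; case: (x == a); case: (y == a); rewrite //= !andbF.
Qed.

Lemma del_vertex_cutr G a b : del_vertex (cut G a b) b = del_vertex G b.
Proof. by rewrite /cut setUC; apply: del_vertex_cut. Qed.

Lemma del_vertex_cutC G a b v : v != a -> v != b ->
  del_vertex (cut G a b) v = cut (del_vertex G v) a b.
Proof.
move=> va vb; apply: graph_ext => [|x y]; first by apply/setP => x; rewrite !inE.
rewrite adj_del !adj_cut adj_del.
by case: (x == v); case: (y == v); rewrite //= andbF.
Qed.

(** Twins are never adjacent: the last clause at [b] equates [adj G a b] with [adj G b b]. The
    middle clause matters for isolated vertices, whose presence adjacency does not reveal. *)
Definition twins G a b :=
  [/\ a != b, (a \in vset G) = (b \in vset G) & adj G a =1 adj G b].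

Lemma twins_cut G a b x y : x != a -> x != b -> y != a -> y != b ->
  twins G a b -> twins (cut G x y) a b.
Proof.
move=> xa xb ya yb [ab Vab Aab]; split => // c.
rewrite !adj_cut Aab !(eq_sym a) !(eq_sym b).
by rewrite (negbTE xa) (negbTE xb) (negbTE ya) (negbTE yb).
Qed.

Lemma twins_del G a b v : v != a -> v != b ->
  twins G a b -> twins (del_vertex G v) a b.
Proof.
move=> va vb [ab Vab Aab]; split => // [|c].
  by rewrite !inE Vab !(eq_sym _ v) va vb.
by rewrite !adj_del Aab !(eq_sym _ v) va vb.
Qed.

Lemma twins_sym G a b : twins G a b -> twins G b a.
Proof. by case=> ab Vab Aab; split=> [||c]; rewrite ?Aab // eq_sym. Qed.

(** This is the position after cutting an edge at one twin and answering with the mirror image. *)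
Lemma twins_cut2 G a b c : c != a -> c != b ->
  twins G a b -> twins (cut (cut G a c) b c) a b.
Proof.
move=> ca cb [ab Vab Aab]; split => // x.
rewrite !adj_cut Aab !eqxx (eq_sym b a) !(negbTE ab) !(eq_sym _ c).
by rewrite (negbTE ca) (negbTE cb) /= !orbF; case: (c == x); rewrite ?andbF.
Qed.

(* A move touching exactly one of the twins is answered by its mirror image. *)
Lemma lost_twins G a b : twins G a b ->
  lost G = lost (del_vertex (del_vertex G a) b).
Proof.
have [k] := ubnP (gsize G); elim: k G a b => // k IH G a b; rewrite ltnS => Gk tw.
have [ab Vab Aab] := tw; set F := del_vertex _ b.
(* A move away from both twins leaves them twins, so by induction it has the same outcome in [G] and
   in [F]. *)
have IHdel v : v != a -> v != b -> v \in vset G ->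
    lost (del_vertex G v) = lost (del_vertex F v).
  move=> va vb vG; rewrite (IH _ a b); last exact: twins_del.
    by rewrite /F (del_vertexC G v a) (del_vertexC (del_vertex G a) v b).
  exact: leq_trans (gsize_del vG) _.
have IHcut x y : x != a -> x != b -> y != a -> y != b -> adj G x y ->
    lost (cut G x y) = lost (cut F x y).
  move=> xa xb ya yb xy; rewrite (IH _ a b); last exact: twins_cut.
    by rewrite /F !del_vertex_cutC // eq_sym.
  exact: leq_trans (gsize_cut xy) _.
have [lF|] := boolP (lost F).
  (* The pair [c], [d] stands for the twins in either order. *)
  have delF c d : twins G c d -> del_vertex (del_vertex G c) d = F ->
    c \in vset G -> ~~ lost (del_vertex G c).
    move=> cd eF cG; have [ncd Vcd _] := cd.
    apply: (@notlost_vertex _ d); first by rewrite !inE eq_sym ncd -Vcd.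
    by rewrite eF.
  have cutF c d x : twins G c d -> del_vertex (del_vertex G c) d = F ->
    adj G c x -> ~~ lost (cut G c x).
    move=> cd eF cx; have [ncd Vcd Acd] := cd.
    have xc : x != c by apply: contraTneq cx => ->; rewrite adj_irrefl.
    have xd : x != d by apply: contraTneq cx => ->; rewrite Acd adj_irrefl.
    have dx : adj (cut G c x) d x.
      by rewrite adj_cut -Acd cx (eq_sym d) (negbTE ncd) (eq_sym d) (negbTE xd).
    apply: notlost_edge (dx) _.
    (* Both cut edges disappear once [c] and [d] are deleted, which leaves [F]. *)
    rewrite (IH _ c d); last exact: twins_cut2.
      by rewrite (del_vertexC _ c d) del_vertex_cut (del_vertexC _ d c) del_vertex_cut eF.
    exact: leq_trans (gsize_cut dx) (leq_trans (ltnW (gsize_cut cx)) Gk).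
  apply: lost_intro => [x y xy|v vG]; last first.
    have [?|va] := eqVneq v a; first by subst v; apply: delF tw _ _.
    have [?|vb] := eqVneq v b.
      by subst v; apply: delF (twins_sym tw) (del_vertexC _ _ _) vG.
    rewrite IHdel //; move/lostP: lF; apply; apply/moveP; constructor.
    by rewrite !inE va vb.
  have cut_b z : adj G b z -> ~~ lost (cut G b z).
    exact: cutF (twins_sym tw) (del_vertexC _ _ _).
  have cut_a z : adj G a z -> ~~ lost (cut G a z) by exact: cutF tw _.
  have [?|xa] := eqVneq x a; first by subst x; apply: cut_a.
  have [?|xb] := eqVneq x b; first by subst x; apply: cut_b.
  have [?|ya] := eqVneq y a; first by subst y; rewrite cutC cut_a // adj_sym.
  have [?|yb] := eqVneq y b; first by subst y; rewrite cutC cut_b // adj_sym.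
  rewrite IHcut //; move/lostP: lF; apply; apply/moveP; constructor.
  by rewrite !adj_del xa xb ya yb.
(* A winning move in [F] cannot touch the deleted twins, so it is available in [G]. *)
case/notlostP => _ /moveP[x y|v] + lH.
  rewrite !adj_del => /and5P[xb yb xa ya xy].
  by apply/negbTE/(notlost_edge xy); rewrite IHcut.
rewrite !inE => /and3P[vb va vG].
by apply/negbTE/(notlost_vertex vG); rewrite IHdel.
Qed.

(** * Cliques with isolated and further vertices *)

(* [Z] consists of isolated vertices, [C] is a clique, and the vertices of [W]
   are adjacent exactly to [N]. *)
Record shape G (Z C W N : {set T}) : Prop := Shape {
  shape_vset : vset G = Z :|: W :|: C;
  shape_ZC : [disjoint Z & C];
  shape_WC : [disjoint W & C];
  shape_ZW : [disjoint Z & W];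
  shape_NC : N \subset C;
  shape_adj : forall x y, adj G x y = (x != y) &&
    [|| (x \in C) && (y \in C), (x \in W) && (y \in N) | (x \in N) && (y \in W)] }.

Lemma shape_del G Z C W N v : shape G Z C W N ->
  shape (del_vertex G v) (Z :\ v) (C :\ v) (W :\ v) (N :\ v).
Proof.
case=> V ZC WC ZW NC A.
have sD (B : {set T}) : B :\ v \subset B by apply: subD1set.
split=> [||||| x y].
- by rewrite vset_del V !setDUl.
- by apply: disjointWl (sD _) _; apply: disjointWr (sD _) _.
- by apply: disjointWl (sD _) _; apply: disjointWr (sD _) _.
- by apply: disjointWl (sD _) _; apply: disjointWr (sD _) _.
- exact: setSD.
- by rewrite adj_del A !inE; case: (x == v); case: (y == v); rewrite //= !andbF.
Qed.

Lemma shape_noW G Z C W N : W = set0 -> shape G Z C W N -> shape G Z C W set0.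
Proof.
move=> W0 [V ZC WC ZW NC A]; split => // [|x y]; first exact: sub0set.
by rewrite A W0 !inE !andbF.
Qed.

(** With a single further vertex, losing one of its edges still leaves a common neighbourhood for
    all of [W]. *)
Lemma shape_cut G Z C w N a : shape G Z C [set w] N -> a \in N ->
  shape (cut G w a) Z C [set w] (N :\ a).
Proof.
move=> [V ZC WC ZW NC A] aN; split => // [|x y].
  exact: subset_trans (subD1set _ _) NC.
have wC : w \notin C by rewrite disjoints1 in WC.
have wN : w \notin N by apply: contra wC => /(subsetP NC).
have aC := subsetP NC a aN.
rewrite adj_cut A !inE.
have [->|xw] := eqVneq x w; have [->|yw] := eqVneq y w.
all: rewrite ?eqxx ?(negbTE wC) ?(negbTE wN) ?andbF ?orbF //=.
all: by do 2?[case: (_ == _)].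
Qed.

Lemma lost_cut_twins G a b : twins (cut G a b) a b ->
  lost (cut G a b) = lost (del_vertex (del_vertex G a) b).
Proof. by move/lost_twins ->; rewrite del_vertex_cut. Qed.

(** * The outcome function and its arithmetic modulo 3 *)

(* [z], [w] tell whether there is an isolated vertex and a further vertex;
   [i] is irrelevant in the absence of the latter. *)
Definition Bwins (z w : bool) n i :=
  match z, w with
  | false, false => n %% 3 == 0
  | true, false => n %% 3 == 1
  | false, true => (n %% 3 == 1) && (i %% 3 == 0) || (n %% 3 == 2) && (i %% 3 == 2)
  | true, true => (n %% 3 == 0) && (i %% 3 == 0) || (n %% 3 == 2) && (i %% 3 == 1)
  end.

(** For a cut edge with exactly one end in [N]: the disjuncts come from replying by deleting the
    further vertex, or by cutting its edge to that end. Either way the ends become twins, whence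
    [n.-2]. *)
Lemma Bwins_mixed z n i : Bwins z true n i -> 0 < i -> i < n ->
  Bwins z false n.-2 0 || Bwins z true n.-2 i.-1.
Proof. by case: z; rewrite /Bwins; lia. Qed.

Lemma Bwins_w z (w : bool) n i : w -> Bwins z w n i -> Bwins z true n i.
Proof. by case: w. Qed.

(** The clauses are, in order: delete the isolated vertex, the further vertex, a clique vertex
    outside [N]; cut an edge outside [N]; delete a vertex of [N]; cut an edge at the further vertex;
    cut an edge inside [N]. *)
Lemma Bwins_option z w n i : Bwins z w n i -> i <= n ->
  [/\ z -> ~~ Bwins false w n i, w -> ~~ Bwins z false n 0,
     0 < n -> i < n -> ~~ Bwins z w n.-1 i & 1 < n -> i.+1 < n -> ~~ Bwins z w n.-2 i] /\
  (0 < i -> w -> [/\ ~~ Bwins z w n.-1 i.-1, ~~ Bwins z w n i.-1 &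
                1 < i -> ~~ Bwins z w n.-2 i.-2]).
Proof. by case: z; case: w; rewrite /Bwins => H; do !split; lia. Qed.

(** A winning move is always found without cutting a clique edge that meets [N]. *)
Lemma Bwins_move z w n i : ~~ Bwins z w n i -> i <= n -> (~~ w -> i = 0) ->
  (z /\ Bwins false w n i) \/ (w /\ Bwins z false n 0) \/
  (0 < i /\ Bwins z w n.-1 i.-1) \/ (i < n /\ Bwins z w n.-1 i) \/
  (i.+1 < n /\ Bwins z w n.-2 i) \/ ([/\ w, 0 < i & Bwins z w n i.-1]).
Proof.
move=> B le_in w0.
(* Naming the residues makes the case split finite; in each case one disjunct works for all [n] and
   [i]. *)
have [r [s [rE sE r3 s3]]] : exists r s, [/\ n %% 3 = r, i %% 3 = s, r < 3 & s < 3].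
  by exists (n %% 3), (i %% 3); rewrite !ltn_mod.
move: B w0; rewrite /Bwins rE sE.
case: z; case: w => B w0; do 3?[case: r rE r3 B => [|r] rE r3 B //];
  do 3?[case: s sE s3 B => [|s] sE s3 B //]; try (have {}w0 := w0 isT);
  move: B => /= B; rewrite ?andbT ?andbF ?orbF //=.
all: first [ by left | by right; left
  | by right; right; left; clear B w0; lia
  | by right; right; right; left; clear B ; lia
  | by right; right; right; right; left; clear B ; lia
  | by right; right; right; right; right; split => //; clear B w0; lia ].
Qed.

(** * Outcomes of all shapes *)

Lemma lost_shape G Z C W N (z w : bool) :
  shape G Z C W N -> #|Z| = z -> #|W| = w -> lost G = Bwins z w #|C| #|N|.
Proof.
have [k] := ubnP (gsize G).
elim: k G Z C W N z w => // k IH G Z C W N z w; rewrite ltnS => Gk + cZ cW.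
(* Without a further vertex [N] carries no information and [Bwins] ignores its size. Taking it empty
   supplies the last hypothesis of [Bwins_move]. *)
wlog N0 : N / W = set0 -> N = set0 => [wl sG|sG].
  have [W0|W0] := eqVneq W set0; last by apply: wl => // /eqP; rewrite (negbTE W0).
  rewrite (wl set0) //; last exact: shape_noW sG.
  by move: cW; rewrite W0 cards0 /Bwins; case: (z); case: (w).
case: (sG) => V ZC WC ZW NC A.
have IHm G' Z' C' W' N' (z' w' : bool) : gsize G' < gsize G -> shape G' Z' C' W' N' ->
    #|Z'| = z' -> #|W'| = w' -> lost G' = Bwins z' w' #|C'| #|N'|.
  by move=> G'G; apply: IH; apply: leq_trans G'G Gk.
have NCc : #|N| <= #|C| by apply: subset_leq_card.
have ZCF x : x \in Z -> x \notin C by move=> xZ; rewrite (disjointFr ZC xZ).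
have ZWF x : x \in Z -> x \notin W by move=> xZ; rewrite (disjointFr ZW xZ).
have WCF x : x \in W -> x \notin C by move=> xW; rewrite (disjointFr WC xW).
have CNF x : x \notin C -> x \notin N by apply: contra => /(subsetP NC).
have CZF x : x \in C -> x \notin Z by move=> xC; rewrite (disjointFl ZC xC).
have CWF x : x \in C -> x \notin W by move=> xC; rewrite (disjointFl WC xC).
have WZF x : x \in W -> x \notin Z by move=> xW; rewrite (disjointFl ZW xW).
have NCF x : x \in N -> x \in C by apply: (subsetP NC).
have cD (B : {set T}) v : v \in B -> #|B :\ v| = #|B|.-1.
  by move=> vB; rewrite (cardsD1 v B) vB.
have D0 (B : {set T}) v : v \notin B -> B :\ v = B.
  by move=> vB; apply/setP => x; rewrite !inE; case: eqP => // ->; rewrite (negbTE vB).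
have delZ v : v \in Z -> z /\ lost (del_vertex G v) = Bwins false w #|C| #|N|.
  move=> vZ; have z1 : z by move: cZ; rewrite (cardsD1 v) vZ; case: (z).
  split=> //; rewrite (IHm _ _ _ _ _ false w _ (shape_del v sG)).
  - by rewrite !D0 ?ZCF ?CNF ?ZCF.
  - by apply: gsize_del; rewrite V !inE vZ.
  - by rewrite cD // cZ z1.
  - by rewrite D0 ?ZWF.
have delW v : v \in W -> w /\ lost (del_vertex G v) = Bwins z false #|C| 0.
  move=> vW; have w1 : w by move: cW; rewrite (cardsD1 v) vW; case: (w).
  split=> //; rewrite (IHm _ _ _ _ _ z false _ (shape_del v sG)).
  - by rewrite !(D0 C) ?WCF //; case: (z).
  - by apply: gsize_del; rewrite V !inE vW orbT.
  - by rewrite D0 ?WZF.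
  - by rewrite cD // cW w1.
have CV v : v \in C -> v \in vset G by move=> vC; rewrite V !inE vC orbT.
have delC v : v \in C -> lost (del_vertex G v) = Bwins z w #|C|.-1 #|N :\ v|.
  move=> vC; rewrite (IHm _ _ _ _ _ z w _ (shape_del v sG)) ?(cD C) //.
  - exact/gsize_del/CV.
  - by rewrite D0 ?CZF.
  - by rewrite D0 ?CWF.
have del2 a b : a \in C -> b \in C -> a != b ->
  lost (del_vertex (del_vertex G a) b) = Bwins z w #|C|.-2 #|N :\ a :\ b|.
  move=> aC bC ab; rewrite (IHm _ _ _ _ _ z w _ (shape_del b (shape_del a sG))).
  - by rewrite (cD (C :\ a)) ?(cD C) // !inE eq_sym ab.
  - apply: ltn_trans (gsize_del (CV _ aC)); apply: gsize_del.
    by rewrite !inE eq_sym ab CV.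
  - by rewrite !(D0 Z) ?CZF.
  - by rewrite !(D0 W) ?CWF.
have adjC a b : a \in C -> b \in C -> a != b -> adj G a b.
  by move=> aC bC ab; rewrite A ab aC bC.
(* Ends on the same side of [N] become twins as soon as their edge is cut. *)
have cutC2 a b : a \in C -> b \in C -> a != b -> (a \in N) = (b \in N) ->
    lost (cut G a b) = Bwins z w #|C|.-2 #|N :\ a :\ b|.
  move=> aC bC ab Nab; rewrite lost_cut_twins ?del2 //.
  split=> // [|x]; first by rewrite vset_cut !CV.
  rewrite !adj_cut !A !eqxx (eq_sym b a) (negbTE ab) aC bC Nab.
  rewrite (negbTE (CWF _ aC)) (negbTE (CWF _ bC)) !(eq_sym _ x) /= !orbF.
  by case: (x == a); case: (x == b).
have cutWN v a : v \in W -> a \in N -> w /\ lost (cut G v a) = Bwins z w #|C| #|N|.-1.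
  move=> vW aN; have w1 : w by move: cW; rewrite (cardsD1 v) vW; case: (w).
  have W1 : W = [set v].
    by move: cW; rewrite w1 => /eqP/cards1P[u Wu]; move: vW; rewrite Wu inE => /eqP->.
  split=> //; rewrite -(cD _ a) //; apply: (IHm _ Z C W) => //.
    apply: gsize_cut; rewrite A vW aN orbT andbT.
    by apply: contraTneq vW => ->; rewrite CWF ?NCF.
  by rewrite W1; apply: shape_cut => //; rewrite -W1.
have cutNO a b : a \in N -> b \in C -> b \notin N -> Bwins z w #|C| #|N| ->
    ~~ lost (cut G a b).
  move=> aN bC bN Bw; have aC := NCF _ aN.
  have ab : a != b by apply: contraTneq aN => ->.
  have [W0|[v vW]] := set_0Vmem W; first by rewrite N0 ?inE in aN.
  have w1 : w by move: cW; rewrite (cardsD1 v) vW; case: (w).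
  have W1 : W = [set v].
    by move: cW; rewrite w1 => /eqP/cards1P[u Wu]; move: vW; rewrite Wu inE => /eqP->.
  have va : v != a by apply: contraTneq vW => ->; apply: CWF.
  have vb : v != b by apply: contraTneq vW => ->; apply: CWF.
  have vV : v \in vset G by rewrite V !inE vW orbT.
  have cN : 0 < #|N| by apply/card_gt0P; exists a.
  have cNC : #|N| < #|C|.
    by apply: proper_card; apply/properP; split=> //; exists b.
  have [Bd|Bc] := orP (Bwins_mixed (Bwins_w w1 Bw) cN cNC).
    (* Once [v] is gone, membership in [N] no longer distinguishes [a] from [b]. *)
    apply: (@notlost_vertex _ v) => //.
    rewrite (@lost_twins _ a b); last first.
      split=> // [|x]; first by rewrite !inE !(eq_sym _ v) va vb !CV.
      rewrite !adj_del !adj_cut !A !eqxx (eq_sym b a) (negbTE ab) aC bC W1 !inE.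
      rewrite !(eq_sym _ v) va vb (negbTE va) (negbTE vb) !(eq_sym _ x) /= (negbTE bN).
      by case: (x == a); case: (x == b); case: (x == v); rewrite //= ?andbF.
    rewrite (del_vertexC _ v a) del_vertex_cut.
    rewrite (IHm _ _ _ _ _ z false _ (shape_del b (shape_del v (shape_del a sG)))).
    - have vC := WCF _ vW.
      have -> : C :\ a :\ v = C :\ a by apply: D0; rewrite !inE (negbTE vC) andbF.
      by rewrite (cD (C :\ a)) ?(cD C) // !inE eq_sym ab.
    - apply: ltn_trans (gsize_del vV); rewrite (del_vertexC _ a v).
      have aV : a \in vset (del_vertex G v) by rewrite !inE eq_sym va CV.
      apply: ltn_trans (gsize_del aV); apply: gsize_del.
      by rewrite !inE !(eq_sym b) ab vb CV.
    - by rewrite (D0 Z a (CZF _ aC)) (D0 Z v (WZF _ vW)) (D0 Z b (CZF _ bC)).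
    - by rewrite (D0 W a) ?CWF // W1 setDv set0D cards0.
  (* Cutting the edge [v a] makes [a], like [b], non-adjacent to [v]. *)
  have vaA : adj (cut G a b) v a.
    by rewrite adj_cut A vW aN (negbTE va) (negbTE vb) orbT.
  apply: notlost_edge vaA _.
  rewrite (@lost_twins _ a b); last first.
    split=> // [|x]; first by rewrite !vset_cut !CV.
    rewrite !adj_cut !A !eqxx (eq_sym b a) (negbTE ab) aC bC W1 !inE.
    rewrite !(eq_sym _ v) (negbTE va) (negbTE vb) !(eq_sym _ x) /= (negbTE bN).
    have [->|xv] := eqVneq x v; first by rewrite (negbTE (WCF _ vW)) !andbF.
    by case: (x == a); case: (x == b); rewrite //= ?andbF.
  rewrite del_vertex_cutr del_vertex_cut del2 // (D0 _ b) ?cD //.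
    by rewrite w1.
  by rewrite !inE (negbTE bN) andbF.
have wN : ~~ w -> #|N| = 0.
  by move=> w0; rewrite N0 ?cards0 //; apply/eqP; rewrite -cards_eq0 cW (negbTE w0).
have NP x : x \in N -> 0 < #|N| by move=> xN; apply/card_gt0P; exists x.
have wT x : x \in N -> w by move/NP; apply: contraTT => /wN ->.
have [Bw|nB] := boolP (Bwins z w #|C| #|N|).
  have [[optZ optW optO optO2] opt] := Bwins_option Bw NCc.
  apply: lost_intro => [x y|v].
    rewrite A => /andP[xy /or3P[/andP[xC yC]|/andP[xW yN]|/andP[xN yW]]].
    - have c2 : 1 < #|C| by apply/card_gt1P; exists x, y.
      have [xN|xN] := boolP (x \in N); have [yN|yN] := boolP (y \in N).
      + rewrite cutC2 ?xN ?yN // (cD (N :\ x)) ?(cD N) //;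
          last by rewrite !inE eq_sym xy.
        have n2 : 1 < #|N| by apply/card_gt1P; exists x, y.
        by have [_ _] := opt (ltnW n2) (wT _ xN); apply.
      + exact: cutNO.
      + by rewrite cutC; apply: cutNO.
      + rewrite cutC2 ?(negbTE xN) ?(negbTE yN) // !(D0 N) //.
        apply: optO2 => //; have : 1 < #|C :\: N|.
          by apply/card_gt1P; exists x, y; rewrite !inE xN yN.
        by rewrite cardsDS // ltn_subRL addn1.
    - by have [w1 ->] := cutWN _ _ xW yN; have [_ -> _] := opt (NP _ yN) w1.
    - rewrite cutC; have [w1 ->] := cutWN _ _ yW xN.
      by have [_ -> _] := opt (NP _ xN) w1.
  rewrite V !inE => /orP[/orP[vZ|vW]|vC].
  - by have [z1 ->] := delZ _ vZ; apply: optZ.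
  - by have [w1 ->] := delW _ vW; apply: optW.
  - rewrite delC //; have [vN|vN] := boolP (v \in N).
      by rewrite cD //; have [] := opt (NP _ vN) (wT _ vN).
    have C0 : #|N| < #|C| by apply: proper_card; apply/properP; split=> //; exists v.
    by rewrite D0 //; apply: optO => //; apply: leq_ltn_trans C0.
(* Each arithmetic alternative is now realised by a move; the cardinalities supply the vertices. *)
apply/negbTE; have := Bwins_move nB NCc wN.
case=> [[z1 B]|[[w1 B]|[[i0 B]|[[lt_in B]|[[lt_in B]|[w1 i0 B]]]]]].
- have /card_gt0P[v vZ] : 0 < #|Z| by rewrite cZ z1.
  apply: (@notlost_vertex _ v); first by rewrite V !inE vZ.
  by have [_ ->] := delZ _ vZ.
- have /card_gt0P[v vW] : 0 < #|W| by rewrite cW w1.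
  apply: (@notlost_vertex _ v); first by rewrite V !inE vW orbT.
  by have [_ ->] := delW _ vW.
- have /card_gt0P[v vN] := i0.
  by apply: (@notlost_vertex _ v); rewrite ?CV ?NCF // delC ?NCF // cD.
- have /card_gt0P[v] : 0 < #|C :\: N| by rewrite cardsDS // subn_gt0.
  rewrite inE => /andP[vN vC].
  by apply: (@notlost_vertex _ v); rewrite ?CV // delC // D0.
- have /card_gt1P[x [y []]] : 1 < #|C :\: N| by rewrite cardsDS // ltn_subRL addn1.
  rewrite !inE => /andP[xN xC] /andP[yN yC] xy.
  apply: (@notlost_edge _ x y); first exact: adjC.
  by rewrite cutC2 ?(negbTE xN) ?(negbTE yN) // !(D0 N).
- have /card_gt0P[a aN] := i0.
  have /card_gt0P[v vW] : 0 < #|W| by rewrite cW w1.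
  apply: (@notlost_edge _ v a); last by have [_ ->] := cutWN _ _ vW aN.
  rewrite A vW aN orbT andbT.
  by apply: contraTneq vW => ->; rewrite CWF ?NCF.
Qed.

End Positions.

(** * The graphs of the theorem as shapes *)

Section Kgraphs.

Variable n : nat.

Lemma adj_Kgraph s x y : adj (Kgraph n s) x y = Kadj x y.
Proof.
have Ksym u v : @Kadj n s u v = Kadj v u.
  by case: u v => [a|j] [b|k] //=; rewrite eq_sym.
rewrite /adj /eset /= inE; apply/existsP/idP => [[u /existsP[v]]|xy].
  by rewrite eq_set2 => /andP[uv /orP[]/andP[/eqP-> /eqP->]]; rewrite // Ksym.
by exists x; apply/existsP; exists y; rewrite xy eqxx.
Qed.

(** Taking [m = n] gives the clique, and [m = i] the neighbourhood of the further vertex. *)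
Definition initial k m : {set 'I_n + 'I_k} :=
  [set x : 'I_n + 'I_k | if x is inl a then a < m else false].

Lemma card_initial k m : m <= n -> #|initial k m| = m.
Proof.
move=> le_mn; have -> : initial k m = [set inl (widen_ord le_mn a) | a : 'I_m].
  apply/setP => -[a|j]; rewrite inE; apply/esym.
    apply/imsetP/idP => [[b _ [->]]|am]; first exact: (valP b).
    by exists (Ordinal am) => //; congr inl; apply: val_inj.
  by apply/imsetP => -[].
by rewrite card_imset ?card_ord // => a b [/val_inj].
Qed.

Lemma initial_sub k m : m <= n -> initial k m \subset initial k n.
Proof. by move=> le_mn; apply/subsetP => -[a|j]; rewrite !inE. Qed.

Lemma shape_K1 i : i <= n ->
  shape (Kgraph n [:: i]) set0 (initial 1 n) [set inr ord0] (initial 1 i).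
Proof.
move=> le_in; split=> [|||||x y].
- by apply/setP => -[a|j]; rewrite !inE ?ltn_ord ?orbT // [j]ord1 eqxx.
- by rewrite disjoints_subset sub0set.
- by rewrite disjoints1 inE.
- by rewrite disjoints_subset sub0set.
- exact: initial_sub.
- rewrite adj_Kgraph; case: x y => [a|j] [b|k]; rewrite !inE ?ltn_ord //=.
  + by rewrite andbT.
  + by rewrite [k]ord1 eqxx andbT.
  + by rewrite [j]ord1 eqxx orbF.
  + by rewrite !andbF.
Qed.

Lemma ord2 (j : 'I_2) : j = if j == ord0 then ord0 else ord_max.
Proof. by case: j => [[|[|]]] // ?; apply: val_inj. Qed.

Lemma disjoint_Z2 k m : [disjoint [set inr k] & initial 2 m].
Proof. by rewrite disjoints1 inE. Qed.

Lemma shape_K02 i : i <= n ->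
  shape (Kgraph n [:: 0; i]) [set inr ord0] (initial 2 n) [set inr ord_max] (initial 2 i).
Proof.
move=> le_in; split=> [|||||x y]; try exact: disjoint_Z2.
- apply/setP => -[a|j]; rewrite !inE ?ltn_ord ?orbT //.
  by rewrite [j]ord2; case: (j == ord0).
- by rewrite disjoints1 inE.
- exact: initial_sub.
- rewrite adj_Kgraph; case: x y => [a|j] [b|k]; rewrite !inE ?ltn_ord //=.
  + by rewrite andbT.
  + by rewrite [k]ord2; case: (k == ord0); rewrite /= ?andbF ?andbT.
  + by rewrite [j]ord2; case: (j == ord0); rewrite //= orbF.
  + by rewrite !andbF.
Qed.

(** The set sizes are those of [shape_K1]. As [Kgraph n [:: i]] lives on a different vertex type,
    the two positions are compared through their shapes, not by an equality. *)
Lemma shape_K2_del j i : i <= n ->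
  shape (del_vertex (Kgraph n [:: j; i]) (inr ord0))
    set0 (initial 2 n) [set inr ord_max] (initial 2 i).
Proof.
move=> le_in; split=> [|||||x y]; try exact: disjoint_Z2.
- apply/setP => -[a|k]; rewrite !inE ?ltn_ord ?orbT //.
  by rewrite [k]ord2; case: (k == ord0).
- by rewrite disjoints_subset sub0set.
- by rewrite disjoints_subset sub0set.
- exact: initial_sub.
- rewrite adj_del adj_Kgraph; case: x y => [a|k] [b|l]; rewrite !inE ?ltn_ord //=.
  + by rewrite andbT.
  + by rewrite [l]ord2; case: (l == ord0); rewrite /= ?andbF ?andbT.
  + by rewrite [k]ord2; case: (k == ord0); rewrite //= orbF.
  + by rewrite !andbF.
Qed.

(** The first further vertex has only the neighbour [u], so this cut isolates it. *)
Lemma cut_K12 (u : 'I_n) i : val u = 0 ->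
  cut (Kgraph n [:: 1; i]) (inr ord0) (inl u) = Kgraph n [:: 0; i].
Proof.
move=> u0; apply: graph_ext => // x y; rewrite adj_cut adj_Kgraph (@adj_Kgraph [:: 0; i]).
have eu (a : 'I_n) : (a == u) = (a < 1) by rewrite -val_eqE u0 /= ltnS leqn0.
case: x y => [a|k] [b|l] /=; last by rewrite andbF.
- by rewrite andbF.
- rewrite -[inl a == inl u]/(a == u) eu [l]ord2.
  by case: (l == ord0); case: (a < 1); rewrite //= ?andbF.
- rewrite -[inl b == inl u]/(b == u) eu [k]ord2.
  by case: (k == ord0); case: (b < 1); rewrite //= ?andbF.
Qed.

Lemma del_K12 (u : 'I_n) i : val u = 0 ->
  del_vertex (Kgraph n [:: 1; i]) (inl u) = del_vertex (Kgraph n [:: 0; i]) (inl u).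
Proof. by move=> u0; rewrite -(cut_K12 i u0) del_vertex_cutr. Qed.

End Kgraphs.

Theorem theorem4p4 (n i : nat) (hin : i <= n) :
  (* (i) *)
  (if (n %% 3 == 1) && (i %% 3 == 0) || (n %% 3 == 2) && (i %% 3 == 2)
   then has_winning_strategy PlayerB (Kgraph n [:: i])
   else has_winning_strategy PlayerA (Kgraph n [:: i])) /\
  (* (ii) *)
  (if (n %% 3 == 0) && (i %% 3 == 0) || (n %% 3 == 2) && (i %% 3 == 1)
   then has_winning_strategy PlayerB (Kgraph n [:: 0; i])
   else has_winning_strategy PlayerA (Kgraph n [:: 0; i])) /\
  (* (iii) *)
  (1 <= n ->
   (n %% 3, i %% 3) \in
     [:: (0, 0); (0, 2); (1, 0); (1, 1); (2, 1); (2, 2)] ->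
   has_winning_strategy PlayerA (Kgraph n [:: 1; i])) /\
  (* (iv) *)
  (forall j : nat, j <= n ->
   (n %% 3 == 1) && (i %% 3 == 0) || (n %% 3 == 2) && (i %% 3 == 2) ->
   has_winning_strategy PlayerA (Kgraph n [:: j; i])).
Proof.
have lost1 : lost (Kgraph n [:: i]) = Bwins false true n i.
  by rewrite (lost_shape (z := false) (w := true) (shape_K1 hin)) ?cards0 ?cards1 //
    !card_initial.
have lost2 : lost (Kgraph n [:: 0; i]) = Bwins true true n i.
  by rewrite (lost_shape (z := true) (w := true) (shape_K02 hin)) ?cards1 //
    !card_initial.
have winA j : Bwins false true n i -> has_winning_strategy PlayerA (Kgraph n [:: j; i]).
  move=> Bw; apply: notlost_winA; apply: (@notlost_vertex _ _ (inr ord0)).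
    by rewrite inE.
  by rewrite (lost_shape (z := false) (w := true) (shape_K2_del j hin)) ?cards0 ?cards1 //
    !card_initial.
split; first by have := lost_winner (Kgraph n [:: i]); rewrite lost1 /Bwins; case: ifP.
split; first by have := lost_winner (Kgraph n [:: 0; i]); rewrite lost2 /Bwins; case: ifP.
split=> [n0 ni|j _]; last exact: winA.
have [B1|nB1] := boolP (Bwins false true n i); first exact: winA.
pose u : 'I_n := Ordinal n0; have u0 : val u = 0 by [].
apply: notlost_winA; have [B2|nB2] := boolP (Bwins true true n i).
  have eu : adj (Kgraph n [:: 1; i]) (inr ord0) (inl u) by rewrite adj_Kgraph.
  by apply: (notlost_edge eu); rewrite cut_K12 // lost2.
apply: (@notlost_vertex _ _ (inl u)); first by rewrite inE.
(* The residue pairs still open are (0, 2) and (1, 1). Deleting [u] lowers both numbers by one and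
   gives (2, 1) and (0, 0), where the player to move loses. *)
have [i0 B3] : 0 < i /\ Bwins true true n.-1 i.-1.
  have [[n3 i3]|[n3 i3]] : (n %% 3 = 0 /\ i %% 3 = 2) \/ (n %% 3 = 1 /\ i %% 3 = 1).
  - by move: ni nB1 nB2; rewrite /Bwins !inE !xpair_eqE; lia.
  - by rewrite /Bwins; clear -n3 i3 hin; lia.
  - by rewrite /Bwins; clear -n3 i3 hin; lia.
rewrite del_K12 //.
rewrite (lost_shape (z := true) (w := true) (shape_del (inl u) (shape_K02 hin))).
- have cD m : 0 < m -> m <= n -> #|initial n 2 m :\ inl u| = m.-1.
    move=> m0 mn; have um : inl u \in initial n 2 m by rewrite inE.
    by have := card_initial 2 mn; rewrite (cardsD1 (inl u)) um => /(congr1 predn).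
  by rewrite !cD.
- by rewrite (setDidPl _) ?cards1 // disjoints1 inE.
- by rewrite (setDidPl _) ?cards1 // disjoints1 inE.
Qed.
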